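(* Consider the 36 consecutive patterns of relations $(\underline{R_1,R_2})$ with $R_1,R_2\in\{\leq,\geq,<,>,=,\neq\}$. The following generalized Wilf equivalences hold: (i) $(\underline{\geq,<})\stackrel{ss}{\sim}(\underline{<,\geq})\sim(\underline{\neq,\geq})$; (ii) $(\underline{\geq,\geq})\stackrel{ss}{\sim}(\underline{<,<})$; (iii) $(\underline{\geq,=})\stackrel{ss}{\sim}(\underline{=,\geq})$; (iv) $(\underline{\geq,>})\stackrel{ss}{\sim}(\underline{>,\geq})$; (v) $(\underline{>,=})\stackrel{ss}{\sim}(\underline{=,>})$. Moreover, this list is complete: any two distinct patterns among the 36 that do not appear together in one of the groups (i)–(v) are not Wilf equivalent.
   Context: An inversion sequence of length $n$ is an integer sequence $e=e_1e_2\dots e_n$ with $0\le e_i<i$ for all $i$; $\mathbf{I}_n$ denotes the set of these. For binary relations $R_1,R_2\in\{\leq,\geq,<,>,=,\neq\}$, an inversion sequence $e$ contains the consecutive pattern of relations $(\underline{R_1,R_2})$ if there is an index $i$ with $e_iR_1e_{i+1}$ and $e_{i+1}R_2e_{i+2}$; then $e_ie_{i+1}e_{i+2}$ is an occurrence in position $i$. Otherwise $e$ avoids the pattern; $\mathbf{I}_n(\underline{R_1,R_2})$ is the set of $e\in\mathbf{I}_n$ avoiding it. Two patterns $p,p'$ are Wilf equivalent ($p\sim p'$) if $|\mathbf{I}_n(p)|=|\mathbf{I}_n(p')|$ for all $n$; strongly Wilf equivalent if for all $n,m$ the number of $e\in\mathbf{I}_n$ with exactly $m$ occurrences of $p$ equals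 that for $p'$; super-strongly Wilf equivalent ($p\stackrel{ss}{\sim}p'$) if for all $n$ and all $S\subseteq[n]$ the number of $e\in\mathbf{I}_n$ whose set of positions of occurrences of $p$ is exactly $S$ equals the corresponding number for $p'$. *)

(* Defs.v *)
From HB Require Import structures.
From mathcomp Require Import all_boot.

Set Implicit Arguments.
Unset Strict Implicit.
Unset Printing Implicit Defensive.

Inductive relsym := rLe | rGe | rLt | rGt | rEq | rNe.

Definition relsym_code (R : relsym) : nat :=
  match R with rLe => 0 | rGe => 1 | rLt => 2 | rGt => 3 | rEq => 4 | rNe => 5 end.

Lemma relsym_code_inj : injective relsym_code.
Proof. by case; case. Qed.

HB.instance Definition _ := Equality.copy relsym (inj_type relsym_code_inj).

Definition relsym_rel (R : relsym) : rel nat :=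
  match R with
  | rLe => fun x y => x <= y
  | rGe => fun x y => x >= y
  | rLt => fun x y => x < y
  | rGt => fun x y => x > y
  | rEq => fun x y => x == y
  | rNe => fun x y => x != y
  end.

(* (R1, R2) is the consecutive pattern of relations written with R1, R2
   underlined; this type has 36 elements. *)
Definition pattern := (relsym * relsym)%type.

(* Indices are shifted by one: nth 0 e i is the letter e_{i+1}, so the condition
   e_{i+1} < i+1 reads nth 0 e i <= i. *)
Definition is_invseq (e : seq nat) : bool :=
  all (fun i => nth 0 e i <= i) (iota 0 (size e)).

(* Letters of an inversion sequence of length n are < n, hence 'I_n. *)
Definition invseqs (n : nat) : {set n.-tuple 'I_n} :=
  [set e : n.-tuple 'I_n | is_invseq (map val e)].

(* i is the position of an occurrence counted from 0 (i.e. position i+1). *)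
Definition occurs_at (p : pattern) (e : seq nat) (i : nat) : bool :=
  [&& i.+2 < size e,
      relsym_rel p.1 (nth 0 e i) (nth 0 e i.+1)
    & relsym_rel p.2 (nth 0 e i.+1) (nth 0 e i.+2)].

Definition occ_positions (n : nat) (p : pattern) (e : n.-tuple 'I_n) : {set 'I_n} :=
  [set i : 'I_n | occurs_at p (map val e) i].

Definition contains (n : nat) (p : pattern) (e : n.-tuple 'I_n) : bool :=
  [exists i : 'I_n, occurs_at p (map val e) i].

Definition avoiders (n : nat) (p : pattern) : {set n.-tuple 'I_n} :=
  [set e in invseqs n | ~~ contains p e].

Definition wilf_equiv (p q : pattern) : Prop :=
  forall n : nat, #|avoiders n p| = #|avoiders n q|.

Definition super_strong_wilf_equiv (p q : pattern) : Prop :=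
  forall (n : nat) (S : {set 'I_n}),
    #|[set e in invseqs n | occ_positions p e == S]|
    = #|[set e in invseqs n | occ_positions q e == S]|.

Definition groups : seq (seq pattern) :=
  [:: [:: (rGe, rLt); (rLt, rGe); (rNe, rGe)];
      [:: (rGe, rGe); (rLt, rLt)];
      [:: (rGe, rEq); (rEq, rGe)];
      [:: (rGe, rGt); (rGt, rGe)];
      [:: (rGt, rEq); (rEq, rGt)] ].

(* Main.v *)
Require Import Defs.
From mathcomp Require Import all_boot zify.

Set Implicit Arguments.
Unset Strict Implicit.
Unset Printing Implicit Defensive.

(* A complement e_i |-> i - e_i exchanges < and >= position by position, which
   gives (ii) and the first equivalence in (i). For (iii)-(v), inclusion-exclusion
   reduces the claim to counting the sequences with occurrences at least at the
   positions in S. A relation R among >=, >, = acts on functions of a letter by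
   f |-> sum_(x R y) f y; such an operator is a power series in the backward
   shift, since the bound e_i < i is automatic after a weak descent. Hence these
   operators commute, and within each run of prescribed occurrences R1 and R2
   may be exchanged. The non-equivalences are seen from the counts for n <= 6. *)

(** * Inversion sequences as lists *)

(* The sequences t such that 0^k t is an inversion sequence of length k + m. *)
Fixpoint invseq_tails (k m : nat) : seq (seq nat) :=
  if m is m'.+1
  then [seq y :: t | y <- iota 0 k.+1, t <- invseq_tails k.+1 m']
  else [:: [::]].

Lemma mem_invseq_tails m k s :
  s \in invseq_tails k m =
  (size s == m) && all (fun i => nth 0 s i <= k + i) (iota 0 m).
Proof.
elim: m k s => [|m IHm] k [|y s] //.
  by apply/allpairsPdep => -[? [? []]].
have -> : all (fun i => nth 0 (y :: s) i <= k + i) (iota 0 m.+1) =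
    (y <= k) && all (fun i => nth 0 s i <= k.+1 + i) (iota 0 m).
  rewrite /= addn0 (iotaDl 1 0) all_map; congr (_ && _).
  by apply: eq_all => i /=; rewrite addnCA.
rewrite eqSS andbCA -IHm; apply/allpairsPdep/andP.
  by move=> [a [t [+ tm [-> ->]]]]; rewrite mem_iota.
by move=> [yk sm]; exists y, s; rewrite mem_iota.
Qed.

Lemma invseq_tails_uniq k m : uniq (invseq_tails k m).
Proof.
elim: m k => // m IHm k; apply: allpairs_uniq => //; first exact: iota_uniq.
by move=> [a s] [b t] _ _ [-> ->].
Qed.

Lemma size_letters n (e : n.-tuple 'I_n) : size (map val e) = n.
Proof. by rewrite size_map size_tuple. Qed.

Lemma nth_letters n (e : n.-tuple 'I_n) (i : 'I_n) :
  nth 0 (map val e) i = tnth e i.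
Proof. by rewrite (nth_map i) ?size_tuple // -tnth_nth. Qed.

(** Turns counts over a set of tuples into counts over an explicit list, which can be both computed
    and unfolded letter by letter. *)
Lemma card_invseqs n (P : pred (seq nat)) :
  #|[set e in invseqs n | P (map val e)]| = count P (invseq_tails 0 n).
Proof.
rewrite cardE -size_filter -(size_map (fun e : n.-tuple 'I_n => map val e)).
apply/perm_size/uniq_perm.
- rewrite map_inj_uniq ?enum_uniq //.
  exact: inj_comp (inj_map val_inj) val_inj.
- exact/filter_uniq/invseq_tails_uniq.
move=> s; rewrite mem_filter mem_invseq_tails.
apply/mapP/andP => [[e]|[Ps /andP[/eqP sn /allP les]]].
  rewrite mem_enum !inE /is_invseq size_letters => /andP[eI Pe] ->.
  by rewrite size_letters eqxx.
(* The default [i] is never reached, since the letters of [s] are below [n] ([nthi]). *)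
pose e := [tuple insubd i (nth 0 s i) | i < n].
suff es : map val e = s.
  exists e; rewrite // mem_enum !inE es Ps andbT /is_invseq sn.
  exact/allP.
apply: (@eq_from_nth _ 0); rewrite size_letters // => i ltin.
have nthi : nth 0 s i < n.
  by rewrite (leq_ltn_trans (les i _) ltin) ?mem_iota.
by rewrite (nth_letters e (Ordinal ltin)) tnth_mktuple val_insubd nthi.
Qed.

Lemma occurs_at_lt_size p s i : occurs_at p s i -> i < size s.
Proof. by case/and3P => /ltnW/ltnW. Qed.

Definition avoids (p : pattern) (s : seq nat) : bool :=
  ~~ has (occurs_at p s) (iota 0 (size s)).

Lemma card_avoiders n p :
  #|avoiders n p| = count (avoids p) (invseq_tails 0 n).
Proof.
rewrite -card_invseqs; apply: eq_card => e; rewrite !inE; congr (_ && ~~ _).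
rewrite size_letters; apply/existsP/hasP => [[i pi]|[i]].
  by exists (val i); rewrite // mem_iota /=.
by rewrite mem_iota => /= ltin pi; exists (Ordinal ltin).
Qed.

Lemma nth_invseq n (e : n.-tuple 'I_n) i :
  e \in invseqs n -> nth 0 (map val e) i <= i.
Proof.
rewrite inE => /allP le_e; have [lti|gei] := ltnP i (size (map val e)).
  by apply: le_e; rewrite mem_iota.
by rewrite nth_default.
Qed.

(** * The complement [e_i |-> i - e_i] *)

(** The bounds are those on consecutive letters of an inversion sequence; they keep the truncated
    subtractions exact. *)
Definition flips (R R' : relsym) : Prop :=
  forall i x y, x <= i -> y <= i.+1 ->
    relsym_rel R (i - x) (i.+1 - y) = relsym_rel R' x y.

Lemma flips_Ge_Lt : flips rGe rLt.
Proof. by move=> i x y /=; lia. Qed.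

Lemma flips_Lt_Ge : flips rLt rGe.
Proof. by move=> i x y /=; lia. Qed.

Definition compl n (e : n.-tuple 'I_n) : n.-tuple 'I_n :=
  [tuple Ordinal (leq_ltn_trans (leq_subr (tnth e i) i) (ltn_ord i)) | i < n].

Lemma nth_compl n (e : n.-tuple 'I_n) i :
  nth 0 (map val (compl e)) i = if i < n then i - nth 0 (map val e) i else 0.
Proof.
case: ltnP => [lti|gei]; last by rewrite nth_default // size_letters.
by rewrite !(nth_letters _ (Ordinal lti)) tnth_mktuple.
Qed.

Lemma compl_invseq n (e : n.-tuple 'I_n) : compl e \in invseqs n.
Proof.
rewrite inE; apply/allP => i _; rewrite nth_compl.
by case: ifP => // _; apply: leq_subr.
Qed.

Lemma compl_inj n : {in invseqs n &, injective (@compl n)}.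
Proof.
move=> e f eI fI ef; apply/eq_from_tnth => i; apply/val_inj.
have := congr1 (fun g : n.-tuple 'I_n => nth 0 (map val g) i) ef.
have := nth_invseq i eI; have := nth_invseq i fI.
rewrite !nth_compl !nth_letters ltn_ord /=; lia.
Qed.

Lemma occ_positions_compl n (e : n.-tuple 'I_n) (R1 R1' R2 R2' : relsym) :
  flips R1 R1' -> flips R2 R2' -> e \in invseqs n ->
  occ_positions (R1, R2) (compl e) = occ_positions (R1', R2') e.
Proof.
move=> flip1 flip2 eI; apply/setP => i; rewrite !inE /occurs_at.
rewrite !size_letters !nth_compl /=.
case: ltnP => //= lti; rewrite (ltnW lti) ltn_ord.
by rewrite flip1 ?flip2 // ?nth_invseq.
Qed.

(** The complement injects each fibre over [S] into the other one, so two inequalities give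
    equality. *)
Lemma flips_super_strong R1 R2 R1' R2' :
  flips R1 R1' -> flips R1' R1 -> flips R2 R2' -> flips R2' R2 ->
  super_strong_wilf_equiv (R1, R2) (R1', R2').
Proof.
move=> f1 f1' f2 f2' n S; apply/eqP; rewrite eqn_leq.
have le Q1 Q2 Q1' Q2' : flips Q1 Q1' -> flips Q2 Q2' ->
  #|[set e in invseqs n | occ_positions (Q1', Q2') e == S]|
    <= #|[set e in invseqs n | occ_positions (Q1, Q2) e == S]|.
  move=> g1 g2; rewrite -(card_in_imset (f := @compl n)); last first.
    by move=> e f; rewrite !inE => /andP[+ _] /andP[+ _] => eI fI;
       apply: compl_inj; rewrite inE.
  apply/subset_leq_card/subsetP => _ /imsetP[e /setIdP[eI eS] ->].
  by rewrite inE compl_invseq (occ_positions_compl g1 g2).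
by rewrite !le.
Qed.

(** * Avoiding (<, >=) and (<>, >=) *)

(* A positive letter followed by a weak descent has to be reached from
   [e_0 = 0] by an ascent that is directly followed by a weak descent. *)
Lemma pos_weak_descent_contains (s : seq nat) i :
  nth 0 s 0 = 0 -> i.+1 < size s -> nth 0 s i.+1 <= nth 0 s i ->
  0 < nth 0 s i -> exists j, occurs_at (rLt, rGe) s j.
Proof.
move=> s0; elim: i => [|i IHi] lti desc pos; first by rewrite s0 in pos.
have [asc|desc'] := ltnP (nth 0 s i) (nth 0 s i.+1).
  by exists i; apply/and3P.
exact: IHi (ltnW lti) desc' (leq_trans pos desc').
Qed.

(** The avoiders coincide as sets: an occurrence of [(rNe, rGe)] that begins with a descent has a
    positive first letter, which forces an occurrence of [(rLt, rGe)]. *)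
Lemma Lt_Ge_wilf_Ne_Ge : wilf_equiv (rLt, rGe) (rNe, rGe).
Proof.
move=> n; apply: eq_card => e; rewrite !inE.
case eI: (is_invseq _) => //=; congr (~~ _).
apply/existsP/existsP => -[i /and3P[lti /= r1 r2]].
  by exists i; apply/and3P; split; rewrite //= neq_ltn r1.
have [asc|desc|eq] := ltngtP (nth 0 (map val e) i) (nth 0 (map val e) i.+1).
- by exists i; apply/and3P.
- have [|||j occj] := @pos_weak_descent_contains (map val e) i _ (ltnW lti).
  + by apply/eqP; rewrite -leqn0 nth_invseq ?inE.
  + exact: ltnW.
  + exact: leq_ltn_trans desc.
  have := occurs_at_lt_size occj; rewrite size_letters => ltj.
  by exists (Ordinal ltj).
- by rewrite eq eqxx in r1.
Qed.

(** * Reduction to counting sequences with prescribed occurrences *)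

Lemma card_sup_sum (T J : finType) (A : {set T}) (F : T -> {set J})
    (S : {set J}) :
  #|[set e in A | S \subset F e]|
  = \sum_(U : {set J} | S \subset U) #|[set e in A | F e == U]|.
Proof.
rewrite -sum1_card (partition_big F (fun U : {set J} => S \subset U)) /=.
  apply: eq_bigr => U SU; rewrite -sum1_card; apply: eq_bigl => e.
  by rewrite !inE -andbA; case: eqP => [->|]; rewrite ?SU ?andbF.
by move=> e /setIdP[].
Qed.

(** Inclusion-exclusion as an induction on the size of the complement of [S]: the strict supersets
    of [S] contribute equally on both sides, hence so does the term [U = S]. *)
Lemma card_fiber_eq (T J : finType) (A : {set T}) (F G : T -> {set J}) :
  (forall S : {set J},
     #|[set e in A | S \subset F e]| = #|[set e in A | S \subset G e]|) ->
  forall S, #|[set e in A | F e == S]| = #|[set e in A | G e == S]|.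
Proof.
move=> FG S; have [m] := ubnP #|~: S|; elim: m S => // m IHm S ltm.
have := FG S; rewrite !card_sup_sum (bigD1 S) //= [in RHS](bigD1 S) //=.
have -> : \sum_(U : {set J} | (S \subset U) && (U != S))
            #|[set e in A | F e == U]|
        = \sum_(U : {set J} | (S \subset U) && (U != S))
            #|[set e in A | G e == U]|.
  apply: eq_bigr => U /andP[SU neqU]; apply: IHm.
  apply: leq_trans (_ : #|~: U| < #|~: S|) _; last by rewrite -ltnS.
  apply: proper_card; rewrite properEneq setCS; apply/andP; split=> //.
  by apply: contraNneq neqU => /setC_inj ->.
exact: addIn.
Qed.

(* [b i] prescribes an occurrence at position [i] of [x :: t]; [s] prescribes
   one at the position just before [x]. *)
Fixpoint sat (p : pattern) (s : bool) (b : nat -> bool) (x : nat) (t : seq nat) :=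
  if t is y :: t' then
    [&& s ==> relsym_rel p.2 x y, b 0 ==> relsym_rel p.1 x y
      & sat p (b 0) (fun i => b i.+1) y t']
  else ~~ s && ~~ b 0.

Lemma all_iotaS (a : pred nat) n :
  all a (iota 0 n.+1) = a 0 && all (fun i => a i.+1) (iota 0 n).
Proof. by rewrite /= (iotaDl 1 0) all_map. Qed.

Lemma satE p s b x t :
  sat p s b x t =
  (s ==> (if t is y :: _ then relsym_rel p.2 x y else false))
  && all (fun i => b i ==> occurs_at p (x :: t) i) (iota 0 (size t).+1).
Proof.
elim: t s b x => [|y t IHt] s b x; first by rewrite /= andbT; case: s; case: (b 0).
rewrite [LHS]/= IHt [in RHS]all_iotaS; congr (_ && _).
rewrite andbA; congr (_ && _); case: (b 0) => //=.
by case: t {IHt} => [|z t]; rewrite /occurs_at /= ?andbF.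
Qed.

(** * Commuting step operators *)

(** The range stops at [x] instead of the bound on the next letter, so the operator does not depend
    on the position; a weak descent loses no term by this. *)
Definition step_sum (c : rel nat) (f : nat -> nat) (x : nat) : nat :=
  \sum_(y < x.+1 | c x y) f y.

Lemma eq_step_sum (c : rel nat) (f g : nat -> nat) x :
  (forall y, y <= x -> f y = g y) -> step_sum c f x = step_sum c g x.
Proof. by move=> fg; apply: eq_bigr => y _; apply: fg; rewrite -ltnS. Qed.

Lemma step_sum_widen (c : rel nat) (f : nat -> nat) x k :
  (forall y, c x y -> y <= x) -> x <= k ->
  \sum_(y < k.+1 | c x y) f y = step_sum c f x.
Proof.
move=> cle lexk; rewrite /step_sum [RHS](big_ord_widen_cond k.+1 (fun y => c x y) f) //.
by apply: eq_bigl => y; case cxy: (c x y) => //=; rewrite ltnS cle.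
Qed.

(** The second clause, translation invariance, is what makes [step_sum c] a convolution. *)
Definition weak_descent (c : rel nat) : Prop :=
  (forall x y, c x y -> y <= x) /\ (forall x y z, c (x + z) (y + z) = c x y).

Lemma weak_descent_Ge : weak_descent (relsym_rel rGe).
Proof. by split=> /= *; lia. Qed.

Lemma weak_descent_Gt : weak_descent (relsym_rel rGt).
Proof. by split=> /= *; lia. Qed.

Lemma weak_descent_Eq : weak_descent (relsym_rel rEq).
Proof. by split=> /= *; lia. Qed.

Lemma weak_descentI (c d : rel nat) :
  weak_descent c -> weak_descent d -> weak_descent (fun x y => c x y && d x y).
Proof.
move=> [cle cD] [dle dD]; split=> [x y /andP[/cle //]|x y z].
by rewrite cD dD.
Qed.

(** This is the power series in the backward shift, with coefficients [c j 0]. *)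
Lemma step_sum_convE c f x :
  weak_descent c -> step_sum c f x = \sum_(j < x.+1 | c j 0) f (x - j).
Proof.
move=> [_ cD]; rewrite /step_sum (reindex_inj rev_ord_inj) /=.
apply: eq_big => [j|j _]; last by rewrite subSS.
rewrite subSS -[RHS](cD _ _ (x - j)) add0n; congr (c _ _).
by rewrite subnKC // -ltnS.
Qed.

(** Both composites are the sum of [f (x - (i + j))] over [i + j <= x], with one index restricted by
    each relation. *)
Lemma step_sum_comm c d f x :
  weak_descent c -> weak_descent d -> step_sum c (step_sum d f) x = step_sum d (step_sum c f) x.
Proof.
have conv c' d' : weak_descent c' -> weak_descent d' -> step_sum c' (step_sum d' f) x =
    \sum_(j < x.+1) \sum_(i < x.+1 | [&& c' j 0, d' i 0 & i + j <= x])
      f (x - (i + j)).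
  move=> wc wd; rewrite step_sum_convE // big_mkcond; apply: eq_bigr => j _.
  case: ifP => /= cj; last by rewrite big_pred0.
  rewrite step_sum_convE // (big_ord_widen_cond x.+1 (fun i => d' i 0)
    (fun i => f (x - j - i))) ?ltnS ?leq_subr //.
  apply: eq_big => [i|i _]; last by rewrite -subnDA addnC.
  by congr (_ && _); have := ltn_ord j; lia.
move=> wc wd; rewrite !conv // (exchange_big_dep xpredT) //=; apply: eq_bigr => i _.
by rewrite big_mkcond [RHS]big_mkcond; apply: eq_bigr => j _; rewrite addnC andbCA.
Qed.

Definition extensions p s b k m x := count (sat p s b x) (invseq_tails k m).

Lemma extensionsS p s b k m x :
  extensions p s b k m.+1 x =
  \sum_(y < k.+1 | (s ==> relsym_rel p.2 x y) && (b 0 ==> relsym_rel p.1 x y))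
     extensions p (b 0) (fun i => b i.+1) k.+1 m y.
Proof.
rewrite /extensions -[invseq_tails k m.+1]/(flatten
  [seq [seq y :: t | t <- invseq_tails k.+1 m] | y <- iota 0 k.+1]).
rewrite count_flatten -map_comp sumnE big_map.
have -> : iota 0 k.+1 = index_iota 0 k.+1 by rewrite /index_iota subn0.
rewrite big_mkord [RHS]big_mkcond.
apply: eq_bigr => y _; rewrite [LHS]/= count_map; case: ifP => cy.
  by apply: eq_count => t /=; rewrite andbA cy.
rewrite -[RHS](count_pred0 (invseq_tails k.+1 m)).
by apply: eq_count => t /=; rewrite andbA cy.
Qed.

Lemma extensions_trueS p b k m x : weak_descent (relsym_rel p.2) -> x <= k ->
  extensions p true b k m.+1 x =
  step_sum (fun x y => relsym_rel p.2 x y && (b 0 ==> relsym_rel p.1 x y))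
    (extensions p (b 0) (fun i => b i.+1) k.+1 m) x.
Proof.
move=> [desc _] lexk; rewrite extensionsS /= -(step_sum_widen _ _ lexk) //.
by move=> y /andP[/desc].
Qed.

Section Swap.

Variables R1 R2 : relsym.
Hypothesis wd1 : weak_descent (relsym_rel R1).
Hypothesis wd2 : weak_descent (relsym_rel R2).

Let T1 := step_sum (relsym_rel R1).
Let T2 := step_sum (relsym_rel R2).

(* A maximal run of [l] prescribed occurrences acts on functions of the last
   letter as T1 T12^(l-1) T2 for (R1, R2) and as T2 T12^(l-1) T1 for (R2, R1),
   where T12 belongs to the conjunction of R1 and R2; the three commute. *)
Lemma extensions_swap m k b :
  (forall x, x <= k ->
     T1 (extensions (R1, R2) true b k m) x = T2 (extensions (R2, R1) true b k m) x)
  /\ (forall x, x <= k ->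
     extensions (R1, R2) false b k m x = extensions (R2, R1) false b k m x).
Proof.
pose c12 x y := relsym_rel R1 x y && relsym_rel R2 x y.
have wd12 : weak_descent c12 by apply: weak_descentI.
elim: m k b => [|m IHm] k b.
  by split=> // x _; rewrite /T1 /T2 /step_sum !big1.
have [IHt IHf] := IHm k.+1 (fun i => b i.+1).
split=> x lexk; last first.
  rewrite !extensionsS /=; case: (b 0) => /=; last first.
    by apply: eq_bigr => y _; apply: IHf; apply: leqW; rewrite -ltnS.
  (* A run opens here; its first step is the [T1] or [T2] in front of the first claim. *)
  rewrite (step_sum_widen _ (proj1 wd1 x) lexk) (step_sum_widen _ (proj1 wd2 x) lexk).
  exact/IHt/leqW.
have lek y : y <= x -> y <= k by move/leq_trans; apply.
set Ep := extensions (R1, R2) (b 0) (fun i => b i.+1) k.+1 m.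
set Eq := extensions (R2, R1) (b 0) (fun i => b i.+1) k.+1 m.
(* If the run ends here, [T1] and [T2] commute and the second induction hypothesis applies beyond
   them. *)
have [b0|b0] := boolP (b 0); last first.
  have EpEq y : y <= x -> Ep y = Eq y.
    by move=> /lek/leqW leyk; rewrite /Ep /Eq (negbTE b0) IHf.
  transitivity (T1 (T2 Ep) x).
    apply: eq_step_sum => y /lek leyk; rewrite extensions_trueS //.
    by apply: eq_bigl => z; rewrite (negbTE b0) /= andbT.
  rewrite /T1 /T2 step_sum_comm //; apply: eq_step_sum => y leyx.
  rewrite extensions_trueS ?lek // (@eq_step_sum _ Ep Eq).
    by apply: eq_bigl => z; rewrite (negbTE b0) /= andbT.
  by move=> z /leq_trans/(_ leyx); apply: EpEq.
(* The run goes on: this step obeys both relations, and its operator moves out past [T1], then back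
   in past [T2]. *)
transitivity (step_sum c12 (T1 Ep) x).
  rewrite /T1 -step_sum_comm //; apply: eq_step_sum => y /lek leyk; rewrite extensions_trueS //.
  by apply: eq_bigl => z; rewrite b0 andbC.
transitivity (step_sum c12 (T2 Eq) x).
  by apply: eq_step_sum => y /lek/leqW leyk; rewrite /Ep /Eq b0 IHt.
rewrite /T2 step_sum_comm //; apply: eq_step_sum => y /lek leyk; rewrite extensions_trueS //.
by apply: eq_bigl => z; rewrite b0.
Qed.

End Swap.

(** A dummy letter 0 precedes the sequence, so positions shift by one and nothing is prescribed at
    0. *)
Lemma card_sup_occ_positions n p (S : {set 'I_n}) :
  #|[set e in invseqs n | S \subset occ_positions p e]| =
  extensions p false (fun i => (0 < i) && (i.-1 \in map val (enum S))) 0 n 0.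
Proof.
rewrite /extensions -card_invseqs; apply: eq_card => e; rewrite !inE.
congr (_ && _); rewrite satE all_iotaS /= size_letters.
apply/subsetP/allP => [Sp i _|Sp i iS].
  apply/implyP => /mapP[j]; rewrite mem_enum => /Sp + ->.
  by rewrite inE.
have := Sp i; rewrite mem_iota /= ltn_ord => /(_ isT)/implyP.
by rewrite inE; apply; rewrite map_f // mem_enum.
Qed.

Lemma weak_descent_super_strong R1 R2 :
  weak_descent (relsym_rel R1) -> weak_descent (relsym_rel R2) ->
  super_strong_wilf_equiv (R1, R2) (R2, R1).
Proof.
move=> wd1 wd2 n; apply: card_fiber_eq => S; rewrite !card_sup_occ_positions.
by have [_ ->] := extensions_swap wd1 wd2 n 0
  (fun i => (0 < i) && (i.-1 \in map val (enum S))).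
Qed.

(** * Completeness *)

(** Shorter sequences have no room for an occurrence and separate nothing. *)
Definition avoider_counts (p : pattern) : seq nat :=
  [seq count (avoids p) (invseq_tails 0 n) | n <- [:: 3; 4; 5; 6]].

Lemma wilf_equiv_avoider_counts p q :
  wilf_equiv p q -> avoider_counts p = avoider_counts q.
Proof. by move=> pq; apply: eq_map => n; rewrite -!card_avoiders. Qed.

Definition relsyms := [:: rLe; rGe; rLt; rGt; rEq; rNe].

Definition patterns : seq pattern := [seq (R1, R2) | R1 <- relsyms, R2 <- relsyms].

Lemma mem_patterns p : p \in patterns.
Proof. by case: p => -[] -[]. Qed.

(* Length 6 is needed: (<, >) and (<>, >) have the same counts up to length 5. *)
Lemma avoider_counts_separate :
  let table := [seq (p, avoider_counts p) | p <- patterns] in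
  all (fun u => all (fun v =>
    [|| u.1 == v.1, has (fun g => (u.1 \in g) && (v.1 \in g)) groups
      | u.2 != v.2]) table) table.
Proof. by vm_compute. Qed.

Lemma wilf_equiv_groups p q : wilf_equiv p q ->
  p = q \/ exists2 g : seq pattern, g \in groups & p \in g /\ q \in g.
Proof.
move/wilf_equiv_avoider_counts => pq.
have in_table r : (r, avoider_counts r) \in [seq (p, avoider_counts p) | p <- patterns].
  by rewrite (map_f (fun r => (r, avoider_counts r))) ?mem_patterns.
have /allP/(_ _ (in_table p))/allP/(_ _ (in_table q)) := avoider_counts_separate.
rewrite [_.2 != _]/= pq eqxx orbF => /orP[/eqP|/hasP[g gG /andP[pg qg]]]; first by left.
by right; exists g.
Qed.

Theorem theorem2p1 :
  [/\ super_strong_wilf_equiv (rGe, rLt) (rLt, rGe) /\ wilf_equiv (rLt, rGe) (rNe, rGe),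
      super_strong_wilf_equiv (rGe, rGe) (rLt, rLt),
      super_strong_wilf_equiv (rGe, rEq) (rEq, rGe),
      super_strong_wilf_equiv (rGe, rGt) (rGt, rGe)
    & super_strong_wilf_equiv (rGt, rEq) (rEq, rGt)]
  /\ (forall p q : pattern, p <> q ->
        ~ (exists2 g : seq pattern, g \in groups & p \in g /\ q \in g) ->
        ~ wilf_equiv p q).
Proof.
have [GeLt LtGe] := (flips_Ge_Lt, flips_Lt_Ge).
have [[wGe wGt] wEq] := ((weak_descent_Ge, weak_descent_Gt), weak_descent_Eq).
split; last by move=> p q pq pqG /wilf_equiv_groups[].
split; [split; last exact: Lt_Ge_wilf_Ne_Ge| | | |].
- exact: flips_super_strong.
- exact: flips_super_strong.
- exact: weak_descent_super_strong.
- exact: weak_descent_super_strong.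
- exact: weak_descent_super_strong.
Qed.
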